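(* Let $f:A\to B$ be a homomorphism of Abelian groups, and let $G$ be an Abelian group which either contains an element of infinite order or is a direct sum of cyclic groups. If $f\otimes 1_G:A\otimes G\to B\otimes G$ is nontrivial, then for every $k\geq 1$ the homomorphism $f\otimes 1_{\bigotimes^k G}:A\otimes\bigotimes^kG\to B\otimes\bigotimes^kG$ is nontrivial, where $\bigotimes^kG=G\otimes\cdots\otimes G$ ($k$ factors).
   Context: All groups are Abelian; tensor products are over $\mathbb{Z}$. *)

(* Defs.v *)
From HB Require Import structures.
From mathcomp Require Import all_boot all_order all_algebra.
Set Implicit Arguments. Unset Strict Implicit. Unset Printing Implicit Defensive.
Import GRing.Theory.
Local Open Scope ring_scope.

Definition additive_map (M N : zmodType) (h : M -> N) : Prop :=
  forall x y, h (x + y) = h x + h y.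

Definition bilinear_map (M N P : zmodType) (b : M -> N -> P) : Prop :=
  (forall m n1 n2, b m (n1 + n2) = b m n1 + b m n2) /\
  (forall m1 m2 n, b (m1 + m2) n = b m1 n + b m2 n).

Definition is_tensor (M N T : zmodType) (t : M -> N -> T) : Prop :=
  bilinear_map t /\
  forall (P : zmodType) (b : M -> N -> P), bilinear_map b ->
    exists h : T -> P,
      [/\ additive_map h,
          (forall m n, h (t m n) = b m n) &
          (forall h' : T -> P, additive_map h' ->
             (forall m n, h' (t m n) = b m n) -> forall x, h' x = h x)].

(* Given tensor products (TA, tA) of A and C and (TB, tB) of B and C, the
   homomorphism f (x) 1_C : TA -> TB is the unique additive h with
   h (tA a c) = tB (f a) c.  "f (x) 1_C is nontrivial" : that map is not
   the zero map. *)
Definition tensor_id_nontrivial (A B C TA TB : zmodType)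
  (tA : A -> C -> TA) (tB : B -> C -> TB) (f : A -> B) : Prop :=
  exists h : TA -> TB,
    [/\ additive_map h,
        (forall a c, h (tA a c) = tB (f a) c) &
        exists x, h x != 0].

Definition has_elt_of_infinite_order (G : zmodType) : Prop :=
  exists g : G, forall n : nat, (0 < n)%N -> g *+ n != 0.

(* G is the (internal) direct sum of the cyclic subgroups <g i>, i in I. *)
Definition is_direct_sum_of_cyclic (G : zmodType) : Prop :=
  exists (I : eqType) (g : I -> G),
    (forall x : G, exists (s : seq I) (c : I -> int),
        uniq s /\ x = \sum_(i <- s) g i *~ c i) /\
    (forall (s : seq I) (c : I -> int), uniq s ->
        \sum_(i <- s) g i *~ c i = 0 -> forall i, i \in s -> g i *~ c i = 0).

(* Main.v *)
Require Import Defs.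
From HB Require Import structures.
From mathcomp Require Import all_boot all_order all_algebra.
From mathcomp Require Import boolp classical_sets functions zify ring.
Set Implicit Arguments. Unset Strict Implicit. Unset Printing Implicit Defensive.
Import GRing.Theory Num.Theory.
Local Open Scope classical_set_scope.
Local Open Scope ring_scope.

(* It suffices to find b = f a and q in the tensor power with b (x) q nonzero.
   Suppose a group Y carries a bilinear Y * G -> Y, and psi : B -> Y satisfies
   psi b . g0 = psi b <> 0 for some g0; then b (x) g0 (x) ... (x) g0 is sent to
   psi b, hence is nonzero. Given b (x) g <> 0 in B (x) G, such data exist, up to
   replacing b by a multiple, in each case.
   - b and some element of G have infinite order: Y = Q.
   - G is a direct sum of cyclic groups: b (x) g_i <> 0 for some generator g_i, say
     of order n, so b is not in nB; take Y = B/nB and the i-th coordinate G -> Z/n.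
   - p^r b = 0 and b = p^j b' has finite p-height j: then p^j g is not in
     p^(r+j) G, so a character of G is nonzero on p^j g and kills p^(r+j) G. Its
     image is cyclic of order p^m with m > j, so b is not in p^m B; take Y = B/p^m B.
   - p^r b = 0 and b has infinite p-height: b (x) - kills the torsion T of G, so
     g is not in p^r G + T and some g0 is not in p G + T. Take Y = Q/Z; the action
     extends a homomorphism <1/p> -> Hom(G/T, Q/Z), whose target is divisible. *)

(** * Additive maps, subgroups and quotients *)

Section AdditiveMap.
Variables (M N : zmodType) (h : M -> N).
Hypothesis hD : additive_map h.

Lemma additive_map0 : h 0 = 0.
Proof. by apply: (addrI (h 0)); rewrite -hD !addr0. Qed.

Lemma additive_mapN x : h (- x) = - h x.
Proof. by apply: (addrI (h x)); rewrite -hD !subrr additive_map0. Qed.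

Lemma additive_mapB x y : h (x - y) = h x - h y.
Proof. by rewrite hD additive_mapN. Qed.

Lemma additive_mapMn x n : h (x *+ n) = h x *+ n.
Proof. by elim: n => [|n IHn]; rewrite ?additive_map0 // !mulrS hD IHn. Qed.

Lemma additive_mapMz x m : h (x *~ m) = h x *~ m.
Proof.
by case: m => n; rewrite ?NegzE ?mulrNz ?additive_mapN -!pmulrn additive_mapMn.
Qed.

End AdditiveMap.

Definition is_subgroup (M : zmodType) (H : M -> Prop) : Prop :=
  H 0 /\ forall x y, H x -> H y -> H (x - y).

Lemma trivial_subgroup (M : zmodType) : is_subgroup (fun x : M => x = 0).
Proof. by split=> // x y -> ->; rewrite subrr. Qed.

Section Subgroup.
Variables (M : zmodType) (H : M -> Prop).
Hypothesis HH : is_subgroup H.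

Lemma subgroupN x : H x -> H (- x).
Proof. by move=> Hx; rewrite -sub0r; apply: HH.2 => //; exact: HH.1. Qed.

Lemma subgroupD x y : H x -> H y -> H (x + y).
Proof. by move=> Hx Hy; rewrite -[y]opprK; apply: HH.2 => //; exact: subgroupN. Qed.

Lemma subgroupMz x m : H x -> H (x *~ m).
Proof.
move=> Hx; have Hn n : H (x *+ n).
  by elim: n => [|n IHn]; [exact: HH.1|rewrite mulrS; exact: subgroupD].
by case: m => n; rewrite ?NegzE ?mulrNz -!pmulrn; [|apply: subgroupN]; exact: Hn.
Qed.

(** The integers [m] with [x *~ m] in [H] form a subgroup of Z, which is zero or generated by its
    least positive element. *)
Lemma subgroup_least_multiple x :
  (forall m : int, H (x *~ m) -> m = 0) \/
  exists2 n : nat, (0 < n)%N & forall m : int, H (x *~ m) <-> (n %| m)%Z.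
Proof.
have [[n0 n0P]|noex] := pselect (exists n : nat, (0 < n)%N && `[< H (x *~ n%:Z) >]).
  right; have exn : exists n : nat, (0 < n)%N && `[< H (x *~ n%:Z) >] by exists n0.
  case: (ex_minnP exn) => n /andP[n_gt0 /asboolP Hn] nmin.
  exists n => // m; split=> [Hm|/dvdzP[q ->]]; last first.
    by rewrite mulrC mulrzA; exact: subgroupMz.
  apply/dvdz_mod0P.
  have Hr : H (x *~ (m %% n)%Z).
    have -> : (m %% n)%Z = m - (m %/ n)%Z * n by rewrite {2}(divz_eq m n); ring.
    rewrite mulrzBr; apply: HH.2 => //.
    by rewrite mulrC mulrzA; exact: subgroupMz.
  have r_ge0 : 0 <= (m %% n)%Z by apply: modz_ge0; lia.
  have r_lt : (m %% n)%Z < n by apply: ltz_pmod; lia.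
  case: (m %% n)%Z Hr r_ge0 r_lt => // [[|r]] // Hr _ r_lt.
  by have := nmin r.+1; rewrite /= asboolT // => /(_ isT); lia.
left=> m Hm; apply: contrapT => m0; apply: noex; exists `|m|%N.
rewrite absz_gt0; apply/andP; split; first exact/eqP.
apply/asboolP; rewrite abszE; case: (ger0P m) => _ //.
by rewrite mulrNz; exact: subgroupN.
Qed.

End Subgroup.

Lemma quotient_by_subgroup (M : zmodType) (H : M -> Prop) : is_subgroup H ->
  exists (Q : zmodType) (pr : M -> Q),
    [/\ additive_map pr, (forall q, exists x, pr x = q) &
        forall x, pr x = 0 <-> H x].
Proof.
move=> HH; pose P : {pred M} := [pred x | `[< H x >]].
have Pz : zmod_closed P.
  split=> [|x y]; first by apply/asboolP; exact: HH.1.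
  by move=> /asboolP Hx /asboolP Hy; apply/asboolP; apply: HH.2.
pose I : zmodClosed M := HB.pack (P : M -> bool) (GRing.isZmodClosed.Build M P Pz).
exists (Quotient.quot I), (\pi_(Quotient.quot I))%qT; split.
- by move=> x y; rewrite raddfD.
- by move=> q; exists (repr q); rewrite reprK.
move=> x; have := Quotient.idealrBE I x 0; rewrite subr0 raddf0 => E.
by split=> [/eqP|Hx]; [rewrite -E => /asboolP|apply/eqP; rewrite -E; apply/asboolP].
Qed.

(** * Divisible groups and extension of homomorphisms *)

Lemma pairMz (M D : zmodType) (x : M) (d : D) (m : int) :
  (x, d) *~ m = (x *~ m, d *~ m).
Proof.
rewrite [LHS]surjective_pairing; congr (_, _).
  exact: (@additive_mapMz _ _ (@fst M D)).
exact: (@additive_mapMz _ _ (@snd M D)).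
Qed.

(** Divisibility is asked of a predicate, so that [D] can be a full function group and [S] a group
    of characters inside it. *)
Definition divisible_subgroup (D : zmodType) (S : D -> Prop) : Prop :=
  is_subgroup S /\
  forall d (n : nat), S d -> (0 < n)%N -> exists2 e, S e & e *+ n = d.

(* The graph of a homomorphism from a subgroup of [M] to the subgroup [S]. *)
Definition partial_hom (M D : zmodType) (S : D -> Prop) (R : set (M * D)) : Prop :=
  [/\ is_subgroup R, (forall d, R (0, d) -> d = 0) & forall u, R u -> S u.2].

Lemma partial_hom_functional (M D : zmodType) (S : D -> Prop) (R : set (M * D)) x d e :
  partial_hom S R -> R (x, d) -> R (x, e) -> d = e.
Proof.
move=> [Rsub R0 _] Rd Re; apply/eqP; rewrite -subr_eq0; apply/eqP/R0.
by rewrite -(subrr x); exact: (Rsub.2 _ _ Rd Re).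
Qed.

Section Baer.
Variables (M D : zmodType) (S : D -> Prop).
Hypothesis Sdiv : divisible_subgroup S.

(** Only the multiples of [x] already in the domain constrain its image. They are generated by one
    [x *~ n], whose image is divided by [n] inside [S]; if only the zero multiple occurs, [x] goes
    to 0. *)
Lemma partial_hom_extend1 (R : set (M * D)) (x : M) : partial_hom S R ->
  exists R' : set (M * D),
    [/\ partial_hom S R', R `<=` R' & exists d, R' (x, d)].
Proof.
move=> Rhom; have [Rsub R0 RS] := Rhom.
pose dom y := exists d, R (y, d).
have domsub : is_subgroup dom.
  split; first by exists 0; exact: Rsub.1.
  by move=> y z [d Rd] [e Re]; exists (d - e); exact: (Rsub.2 _ _ Rd Re).
have [d Sd dP] : exists2 d, S d & forall m e, R (x *~ m, e) -> e = d *~ m.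
  have [dom0|[n n_gt0 domn]] := subgroup_least_multiple domsub x.
    exists 0; first exact: Sdiv.1.1.
    move=> m e Re; have m0 : m = 0 by apply: dom0; exists e.
    by move: Re; rewrite m0 !mulr0z; exact: R0.
  have [e Re] : dom (x *~ n%:Z) by apply/domn.
  have [d Sd de] := Sdiv.2 _ _ (RS _ Re) n_gt0.
  exists d => // m e' Re'.
  have /domn/dvdzP[q mE] : dom (x *~ m) by exists e'.
  apply: (partial_hom_functional Rhom Re').
  rewrite mE mulrC !mulrzA -[d *~ n]pmulrn de /= -pairMz.
  exact: subgroupMz.
exists [set u | exists v m, R v /\ u = v + (x, d) *~ m]; split; last 2 first.
- by move=> u Ru; exists u, 0; rewrite mulr0z addr0.
- by exists d, 0, 1; split; [exact: Rsub.1|rewrite add0r].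
split.
- split; first by exists 0, 0; split; [exact: Rsub.1|rewrite mulr0z addr0].
  move=> _ _ [v [m [Rv ->]]] [w [k [Rw ->]]].
  exists (v - w), (m - k); split; first exact: Rsub.2.
  by rewrite mulrzBr opprD addrACA.
- move=> e [[y a] [m [Ra]]]; rewrite pairMz => -[/esym ym ->].
  have yE : y = x *~ (- m) by rewrite mulrNz; apply/eqP; rewrite -addr_eq0 ym.
  by rewrite yE in Ra; rewrite (dP _ _ Ra) mulrNz addNr.
move=> _ [v [m [Rv ->]]]; rewrite pairMz /=.
by apply: subgroupD Sdiv.1 _ _ (RS _ Rv) _; exact: subgroupMz Sdiv.1 _ _ Sd.
Qed.

(* Baer's criterion for abelian groups: divisible groups are injective. *)
Lemma Baer_extension (R : set (M * D)) : partial_hom S R ->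
  exists h : M -> D,
    [/\ additive_map h, forall x, S (h x) & forall x d, R (x, d) -> h x = d].
Proof.
move=> Rhom; have [Rsub R0 RS] := Rhom.
(* Zorn is applied to the sets to be added to [R], not to the extensions of [R], so that the empty
   chain is covered. *)
have [A [Ahom Amax]] : exists A, partial_hom S (R `|` A) /\
    forall B, A `<` B -> ~ partial_hom S (R `|` B).
  apply: (@Zorn_bigcup _ [set A | partial_hom S (R `|` A)]) => F FP Ftot /=.
  pose U := \bigcup_(X in F) X.
  have two u v : (R `|` U) u -> (R `|` U) v ->
      exists X, [/\ partial_hom S (R `|` X), (R `|` X) u, (R `|` X) v &
                    R `|` X `<=` R `|` U].
    have sU X : F X -> R `|` X `<=` R `|` U.
      by move=> FX w [Rw|Xw]; [left|right; exists X].
    move=> [Ru|[X FX Xu]] [Rv|[X' FX' Xv]].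
    + by exists set0; rewrite setU0; split=> // w; left.
    + by exists X'; split; [exact: FP|left|right|exact: sU].
    + by exists X; split; [exact: FP|right|left|exact: sU].
    + have [XX'|X'X] := Ftot _ _ FX FX'.
        by exists X'; split; [exact: FP|right; exact: XX'|right|exact: sU].
      by exists X; split; [exact: FP|right|right; exact: X'X|exact: sU].
  split.
  - split; first by left; exact: Rsub.1.
    move=> u v /two uP /uP[X [[Xsub _ _] Xu Xv XU]].
    by apply: XU; exact: Xsub.2.
  - by move=> d du; have [X [[_ X0 _] Xu _ _]] := two _ _ du du; exact: X0.
  - by move=> u uu; have [X [[_ _ XS] Xu _ _]] := two _ _ uu uu; exact: XS.
have total x : exists d, (R `|` A) (x, d).
  have [R' [R'hom RR' [d R'd]]] := partial_hom_extend1 x Ahom.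
  apply: contrapT => nx; apply: (Amax R').
    split; first by move=> u Au; apply: RR'; right.
    by move=> /(_ _ R'd) Ax; apply: nx; exists d; right.
  suff -> : R `|` R' = R' by [].
  by apply/seteqP; split=> u; [case=> // Ru; apply: RR'; left|right].
have [h hP] := choice total.
exists h; split.
- move=> x y; apply: (partial_hom_functional Ahom (hP _)).
  exact: (subgroupD (let: And3 H _ _ := Ahom in H) (hP x) (hP y)).
- by move=> x; case: Ahom => _ _ /(_ _ (hP x)).
- by move=> x d Rxd; apply: (partial_hom_functional Ahom (hP _)); left.
Qed.

(** The condition on [d] makes [y + m x |-> m d] well defined on H + <x>; Baer's criterion extends
    this map. *)
Lemma hom_extending_value (H : M -> Prop) (x : M) (d : D) :
  is_subgroup H -> S d -> (forall m : int, H (x *~ m) -> d *~ m = 0) ->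
  exists h : M -> D,
    [/\ additive_map h, forall y, S (h y), forall y, H y -> h y = 0 & h x = d].
Proof.
move=> HH Sd Hd.
pose R : set (M * D) :=
  [set u | exists y m, H y /\ u = (y + x *~ m, d *~ m)].
have Rhom : partial_hom S R.
  split.
  - split; first by exists 0, 0; rewrite !mulr0z addr0; split=> //; exact: HH.1.
    move=> _ _ [y [m [Hy ->]]] [z [k [Hz ->]]].
    exists (y - z), (m - k); split; first exact: HH.2.
    by rewrite !mulrzBr addrACA -opprD.
  - move=> e [y [m [Hy [/esym/eqP]]]]; rewrite addr_eq0 => /eqP yE ->.
    by apply: Hd; rewrite -[_ *~ _]opprK -yE; exact: subgroupN.
  - by move=> _ [y [m [_ ->]]]; exact: subgroupMz Sdiv.1 _ _ Sd.
have [h [hD hS hR]] := Baer_extension Rhom; exists h; split=> // [y Hy|].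
  by apply: hR; exists y, 0; rewrite !mulr0z addr0.
by apply: hR; exists 0, 1; split; [exact: HH.1|rewrite add0r].
Qed.

End Baer.

(** * The injective groups Q and Q/Z *)

Lemma divisible_rat : divisible_subgroup (fun _ : rat => True).
Proof.
split=> // d n _ n_gt0; exists ((d : rat) / n%:R) => //.
have n0 : n%:R != 0 :> rat by rewrite pnatr_eq0 -lt0n.
by rewrite -[LHS](mulr_natr (_ : rat)) (divfK n0).
Qed.

Definition int_in_rat : zmodClosed rat :=
  GRing.ZmodClosed.clone rat (@Num.int_num_subdef rat) _.
Definition QmodZ : zmodType := Quotient.quot int_in_rat.
Definition Qpr (x : rat) : QmodZ := (\pi_QmodZ x)%qT.

Lemma Qpr_additive : additive_map Qpr.
Proof. by move=> x y; rewrite /Qpr raddfD. Qed.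

Lemma Qpr_surj (y : QmodZ) : exists x, Qpr x = y.
Proof. by exists (repr y); rewrite /Qpr reprK. Qed.

Lemma Qpr_eq0 x : Qpr x = 0 <-> x \is a Num.int.
Proof.
have := Quotient.idealrBE int_in_rat x 0.
by rewrite subr0 raddf0 => ->; split=> /eqP.
Qed.

Lemma divisible_QmodZ : divisible_subgroup (fun _ : QmodZ => True).
Proof.
split=> // y n _ n_gt0; have [x <-] := Qpr_surj y.
have [e _ <-] := divisible_rat.2 x n I n_gt0.
by exists (Qpr e); rewrite // (additive_mapMn Qpr_additive).
Qed.

Definition Qinv (n : nat) : QmodZ := Qpr n%:R^-1.

Lemma QinvMz_eq0 (n : nat) (k : int) : (0 < n)%N ->
  Qinv n *~ k = 0 <-> (n %| k)%Z.
Proof.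
move=> n_gt0; have n0 : n%:R != 0 :> rat by rewrite pnatr_eq0 -lt0n.
rewrite -(additive_mapMz Qpr_additive) Qpr_eq0 -mulrzl; split.
  move=> /intrP[m /(canRL (divfK n0)) E]; apply/dvdzP; exists m.
  by apply/eqP; rewrite -(eqr_int rat) E intrM.
by move=> /dvdzP[q ->]; rewrite intrM mulfK // intr_int.
Qed.

Lemma QmodZ_torsion (n : nat) (y : QmodZ) : (0 < n)%N -> y *+ n = 0 ->
  exists k : int, y = Qinv n *~ k.
Proof.
move=> n_gt0; have n0 : n%:R != 0 :> rat by rewrite pnatr_eq0 -lt0n.
have [x <-] := Qpr_surj y; rewrite -(additive_mapMn Qpr_additive) Qpr_eq0.
move=> /intrP[k E]; exists k; rewrite -(additive_mapMz Qpr_additive); congr Qpr.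
by rewrite -mulrzl -E -(mulr_natr x) mulfK.
Qed.

(** Send [x] to 1/n, where [n] is its order modulo [H], or 2 if that order is infinite. *)
Lemma character_separates (M : zmodType) (H : M -> Prop) (x : M) :
  is_subgroup H -> ~ H x ->
  exists phi : M -> QmodZ,
    [/\ additive_map phi, forall y, H y -> phi y = 0 & phi x <> 0].
Proof.
move=> HH Hx.
suff [n n_gt1 nP] : exists2 n : nat, (1 < n)%N &
    forall m : int, H (x *~ m) -> (n %| m)%Z.
  have [||m Hm|phi [phiD _ phiH phix]] := hom_extending_value divisible_QmodZ
    (H := H) (x := x) (d := Qinv n) => //.
    by apply/QinvMz_eq0; [exact: ltnW|exact: nP].
  exists phi; split=> //; rewrite phix -[Qinv n]mulr1z => /QinvMz_eq0.
  by rewrite dvdzE /= dvdn1; lia.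
have [H0|[n n_gt0 Hn]] := subgroup_least_multiple HH x.
  by exists 2%N => // m /H0 ->.
exists n => [|m /Hn //]; case: n n_gt0 Hn => [|[|n]] // _ Hn.
by case: Hx; rewrite -[x]mulr1z; apply/Hn.
Qed.

(** * The detection criterion and its first instances *)

(* [gam] lets [G] act on [Y] with [psi b] an eigenvector of [g0], so a functional
   nonzero on [b] propagates along all tensor powers of [G]. *)
Definition detected (B G : zmodType) (b : B) : Prop :=
  exists (Y : zmodType) (gam : Y -> G -> Y) (psi : B -> Y) (g0 : G),
    [/\ bilinear_map gam, additive_map psi, psi b <> 0 &
        gam (psi b) g0 = psi b].

Lemma detected_infinite_order (B G : zmodType) (b : B) (g : G) :
  (forall n : nat, (0 < n)%N -> b *+ n != 0) ->
  (forall n : nat, (0 < n)%N -> g *+ n != 0) -> detected G b.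
Proof.
have fun1 (M : zmodType) (x : M) : (forall n : nat, (0 < n)%N -> x *+ n != 0) ->
    exists2 h : M -> rat, additive_map h & h x = 1.
  move=> xinf.
  have [//||h [hD _ _ hx]] := hom_extending_value divisible_rat
    (x := x) (d := 1) (trivial_subgroup M).
    case=> [[|n]|n] //; first by move=> /eqP; rewrite -pmulrn (negPf (xinf _ _)).
    by rewrite NegzE mulrNz => /eqP; rewrite oppr_eq0 -pmulrn (negPf (xinf _ _)).
  by exists h.
move=> /fun1[psi psiD psib] /fun1[h hD hg].
exists rat, (fun y x => y * h x), psi, g; split=> //.
- by split=> y x x'; rewrite ?hD ?mulrDr ?mulrDl.
- by rewrite psib; exact/eqP/oner_neq0.
- by rewrite hg mulr1.
Qed.

Lemma multiples_subgroup (M : zmodType) (n : nat) :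
  is_subgroup (fun x : M => exists y, x = y *+ n).
Proof.
split; first by exists 0; rewrite mul0rn.
by move=> _ _ [y ->] [z ->]; exists (y - z); rewrite mulrnBl.
Qed.

(* [c] is a homomorphism from [G] to [Z/n]; [n = 0] is allowed. *)
Lemma detected_cyclic (B G : zmodType) (b : B) (n : nat) (c : G -> int) (g0 : G) :
  (forall x y, (n %| c (x + y) - (c x + c y))%Z) -> (n %| c g0 - 1)%Z ->
  (~ exists b', b = b' *+ n) -> detected G b.
Proof.
move=> cD cg bn.
have [Q [pr [prD pr_surj pr0]]] := quotient_by_subgroup (multiples_subgroup B n).
(* B/nB is killed by [n], so [c], additive only modulo [n], still gives a bilinear action. *)
have Qn (q : Q) (m k : int) : (n %| m - k)%Z -> q *~ m = q *~ k.
  have [x <-] := pr_surj q => /dvdzP[j mk].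
  apply/eqP; rewrite -subr_eq0 -mulrzBr mk -(additive_mapMz prD); apply/eqP/pr0.
  by exists (x *~ j); rewrite mulrzA -pmulrn.
exists Q, (fun q g => q *~ c g), pr, g0; split=> //.
- split=> [q x y|q q' x]; last exact: mulrzDl.
  by rewrite -mulrzDr; exact: Qn.
- by move=> /pr0.
- by rewrite (Qn _ _ _ cg).
Qed.

(** * Bilinear maps and torsion *)

Section BilinearMap.
Variables (M N T : zmodType) (t : M -> N -> T).
Hypothesis tbil : bilinear_map t.

Lemma bilinear_additivel n : additive_map (t^~ n).
Proof. by move=> x y; exact: tbil.2. Qed.

Lemma bilinear_additiver m : additive_map (t m).
Proof. exact: tbil.1. Qed.

Lemma bilinearMnl m n k : t (m *+ k) n = t m n *+ k.
Proof. exact: (additive_mapMn (bilinear_additivel n)). Qed.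

Lemma bilinearMnr m n k : t m (n *+ k) = t m n *+ k.
Proof. exact: (additive_mapMn (bilinear_additiver m)). Qed.

Lemma bilinear0l n : t 0 n = 0.
Proof. exact: (additive_map0 (bilinear_additivel n)). Qed.

Lemma bilinear0r m : t m 0 = 0.
Proof. exact: (additive_map0 (bilinear_additiver m)). Qed.

End BilinearMap.

Lemma coprime_torsion (M : zmodType) (x : M) (m n : int) :
  coprimez m n -> x *~ m = 0 -> x *~ n = 0 -> x = 0.
Proof.
move=> /coprimezP[[u v] /= uv] xm xn.
by rewrite -[x]mulr1z -uv mulrzDr (mulrC u) (mulrC v) !mulrzA xm xn !mul0rz addr0.
Qed.

Lemma prime_coprimez (p : nat) (m : int) : prime p -> ~~ (p %| m)%Z -> coprimez m p.
Proof. by move=> p_pr; rewrite coprimezE coprime_sym prime_coprime // dvdzE. Qed.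

Lemma prime_torsion_dvd (M : zmodType) (x : M) (p : nat) (m : int) :
  prime p -> x <> 0 -> x *+ p = 0 -> x *~ m = 0 -> (p %| m)%Z.
Proof.
move=> p_pr x0 xp xm; apply: contraPT x0 => /(prime_coprimez p_pr) cop.
by apply; exact: coprime_torsion cop xm xp.
Qed.

Definition is_torsion (G : zmodType) (x : G) : Prop :=
  exists2 n : nat, (0 < n)%N & x *+ n = 0.

Lemma torsion_subgroup (G : zmodType) : is_subgroup (@is_torsion G).
Proof.
split; first by exists 1%N.
move=> x y [n n_gt0 xn] [m m_gt0 ym]; exists (n * m)%N; first by rewrite muln_gt0 n_gt0.
by rewrite mulrnBl mulrnA xn mulnC mulrnA ym !mul0rn subr0.
Qed.

Definition torsion_free_character (G : zmodType) (phi : G -> QmodZ) : Prop :=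
  additive_map phi /\ forall x, is_torsion x -> phi x = 0.

(* [Hom(G/tors, Q/Z)] is divisible since [G/tors] is torsion free and [Q/Z] injective. *)
Lemma divisible_torsion_free_character (G : zmodType) :
  divisible_subgroup (@torsion_free_character G).
Proof.
split.
  split; first by split=> // x y; rewrite addr0.
  move=> phi psi [phiD phiT] [psiD psiT]; split=> [x y|x Tx].
    by rewrite /= /GRing.add /= /GRing.opp /= phiD psiD opprD addrACA.
  by rewrite /GRing.add /= /GRing.opp /= phiT // psiT // subr0.
move=> phi n [phiD phiT] n_gt0.
(* The graph of [n y + s |-> phi y], well defined because [y] is torsion as soon as [n y] is. An
   extension [h] satisfies n h = phi. *)
pose R : set (G * QmodZ) := [set u | exists y s, is_torsion s /\ u = (y *+ n + s, phi y)].
have Rhom : partial_hom (fun _ => True) R.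
  split=> //.
  - split.
      exists 0, 0; split; first exact: (torsion_subgroup G).1.
      by rewrite mul0rn addr0 (additive_map0 phiD).
    move=> _ _ [y [s [Ts ->]]] [y' [s' [Ts' ->]]]; exists (y - y'), (s - s').
    split; first exact: (torsion_subgroup G).2.
    by rewrite mulrnBl addrACA -opprD (additive_mapB phiD).
  - move=> d [y [s [[k k_gt0 sk] [/esym/eqP]]]]; rewrite addr_eq0 => /eqP yn ->.
    apply: phiT; exists (n * k)%N; first by rewrite muln_gt0 n_gt0.
    by rewrite mulrnA yn mulNrn sk oppr0.
have [h [hD _ hR]] := Baer_extension divisible_QmodZ Rhom.
exists h; first split=> // [x Tx].
  by apply: hR; exists 0, x; rewrite mul0rn add0r (additive_map0 phiD).
apply/funext => x; rewrite natmulfctE -(additive_mapMn hD); apply: hR.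
by exists x, 0; split; [exact: (torsion_subgroup G).1|rewrite addr0].
Qed.

(** * Elements of prime power order *)

Section PrimaryElement.
Variables (B G T : zmodType) (t : B -> G -> T).
Hypothesis tbil : bilinear_map t.
Variables (p r : nat) (b : B) (g : G).
Hypotheses (p_pr : prime p) (br : b *+ p ^ r = 0) (tbg : t b g <> 0).

Lemma detected_finite_height i0 :
  ~ (exists b', b = b' *+ p ^ i0) -> detected G b.
Proof.
move=> bi0; have pX_gt0 k : (0 < p ^ k)%N by rewrite expn_gt0 prime_gt0.
have exi : exists i, ~~ `[< exists b', b = b' *+ p ^ i >] by exists i0; apply/asboolP.
(* The least failing exponent is [j.+1], so [b] has height exactly [j]. *)
case: (ex_minnP exi) => -[|j] /asboolP bj jmin; first by case: bj; exists b.
have [b' bE] : exists b', b = b' *+ p ^ j.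
  by apply: contrapT => /asboolPn/jmin; rewrite ltnn.
(* Otherwise b (x) g = b' (x) p^j g = b' (x) p^(r+j) y = p^r b (x) y = 0. *)
have gj : ~ exists y, g *+ p ^ j = y *+ p ^ (r + j).
  move=> [y gy]; apply: tbg; rewrite bE (bilinearMnl tbil) -(bilinearMnr tbil) gy.
  rewrite (bilinearMnr tbil) expnD mulnC mulrnA -(bilinearMnl tbil) -bE.
  by rewrite -(bilinearMnl tbil) br (bilinear0l tbil).
have [phi [phiD phi0 phig]] := character_separates (multiples_subgroup G _) gj.
have exm : exists m, `[< forall x, phi x *+ p ^ m = 0 >].
  exists (r + j)%N; apply/asboolP => x; rewrite -(additive_mapMn phiD).
  by apply: phi0; exists x.
case: (ex_minnP exm) => m /asboolP phim mmin.
have lt_jm : (j < m)%N.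
  rewrite ltnNge; apply/negP => le_mj; apply: phig.
  by rewrite (additive_mapMn phiD) -(subnKC le_mj) expnD mulrnA phim mul0rn.
case: m lt_jm phim mmin => // m lt_jm phim mmin.
(* By minimality of [m.+1], some value [phi z] has order exactly p^(m+1). *)
have [z phiz] : exists z, phi z *+ p ^ m <> 0.
  apply: contrapT => nz; suff /asboolP/mmin : forall x, phi x *+ p ^ m = 0.
    by rewrite ltnn.
  by move=> x; apply: contrapT => nx; apply: nz; exists x.
(* [c y] is a numerator of [phi y] over p^(m+1), hence additive modulo p^(m+1). *)
have [c cP] := choice (fun y => QmodZ_torsion (pX_gt0 m.+1) (phim y)).
have dvdc k l : Qinv (p ^ m.+1) *~ k = Qinv (p ^ m.+1) *~ l -> ((p ^ m.+1)%N %| k - l)%Z.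
  by move=> kl; apply/(QinvMz_eq0 _ (pX_gt0 _)); rewrite mulrzBr kl subrr.
have copz : coprimez (c z) (p ^ m.+1)%N.
  rewrite coprimezE coprimeXr // -[p]/(`|p%:Z|%N) -coprimezE.
  apply: prime_coprimez => //; apply/negP => /dvdzP[q cq]; apply: phiz.
  rewrite cP cq pmulrn -mulrzA; apply/QinvMz_eq0 => //.
  by rewrite expnS PoszM -mulrA dvdz_mull.
(* [u] inverts [c z] modulo p^(m+1), so [c] is 1 there on [z *~ u]. *)
have /coprimezP[[u v] /= uv] := copz.
apply: (@detected_cyclic _ _ _ (p ^ m.+1) c (z *~ u)).
- by move=> x y; apply: dvdc; rewrite -cP phiD mulrzDr -!cP.
- have -> : c (z *~ u) - 1 = (c (z *~ u) - c z * u) - v * (p ^ m.+1)%N.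
    by rewrite -uv; ring.
  rewrite rpredB //; last exact: dvdz_mull.
  by apply: dvdc; rewrite -cP (additive_mapMz phiD) [in LHS]cP mulrzA.
move=> [b'' b''E]; apply: bj; exists (b'' *+ p ^ (m - j)).
by rewrite -mulrnA -expnD addnS subnK // b''E.
Qed.

Lemma detected_infinite_height :
  (forall i, exists b', b = b' *+ p ^ i) -> exists k, detected G (b *+ k).
Proof.
move=> bdiv.
pose H k x := exists y s : G, is_torsion s /\ x = y *+ p ^ k + s.
have Hsub : is_subgroup (H 1%N).
  split.
    by exists 0, 0; split; [exact: (torsion_subgroup G).1|rewrite mul0rn addr0].
  move=> _ _ [y [s [Ts ->]]] [y' [s' [Ts' ->]]]; exists (y - y'), (s - s').
  by split; [exact: (torsion_subgroup G).2|rewrite mulrnBl addrACA -opprD].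
(* Otherwise b (x) g = b (x) s with [s] torsion of order dividing p^a m, [m] prime to [p]. This is
   killed by p^r, and also by [m] because b = p^a b'. *)
have gH : ~ H r g.
  move=> [y [s [[n n_gt0 sn] gE]]].
  have tE : t b g = t b s.
    by rewrite gE tbil.1 (bilinearMnr tbil) -(bilinearMnl tbil) br
      (bilinear0l tbil) add0r.
  have [m cop_pm nE] := pfactor_coprime p_pr n_gt0.
  have [b' bE] := bdiv (logn p n).
  apply: tbg; rewrite tE.
  apply: (@coprime_torsion _ _ (p ^ r)%N m).
  - by rewrite coprimezE coprimeXl.
  - by rewrite -pmulrn -(bilinearMnl tbil) br (bilinear0l tbil).
  - rewrite -pmulrn bE (bilinearMnl tbil) -mulrnA mulnC -nE.
    by rewrite -(bilinearMnr tbil) sn (bilinear0r tbil).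
(* If G = pG + T, then iterating gives G = p^r G + T. *)
have [g0 g0H] : exists g0, ~ H 1%N g0.
  apply: contrapT => /forallNP/= allH; apply: gH; move: g.
  elim: r => [|k IHk] x.
    by exists x, 0; split; [exact: (torsion_subgroup G).1|rewrite addr0].
  have [y [s [Ts xE]]] := IHk x; have [z [s' [Ts' yE]]] := contrapT (allH y).
  exists z, (s' *+ p ^ k + s); split.
    apply: subgroupD (torsion_subgroup G) _ _ _ Ts.
    by rewrite pmulrn; exact: subgroupMz (torsion_subgroup G) _ _ Ts'.
  by rewrite xE yE mulrnDl -mulrnA -expnD addrA.
have g0p (m : int) : H 1%N (g0 *~ m) -> (p %| m)%Z.
  apply: contraPT => /(prime_coprimez p_pr)/coprimezP[[u v] /= uv] Hm; apply: g0H.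
  rewrite -[g0]mulr1z -uv mulrzDr; apply: subgroupD => //.
    by rewrite mulrC mulrzA; exact: subgroupMz.
  exists (g0 *~ v), 0; split; first exact: (torsion_subgroup G).1.
  by rewrite mulrzA addr0.
have Qp (M : zmodType) (f : M) (m : int) : f *+ p = 0 -> (p %| m)%Z -> f *~ m = 0.
  by move=> fp /dvdzP[q ->]; rewrite mulrC mulrzA -pmulrn fp mul0rz.
have p_gt0 := prime_gt0 p_pr.
have Qinvp : Qinv p *+ p = 0 by rewrite pmulrn; apply/QinvMz_eq0.
(* Replace [b] by its last nonzero multiple by a power of [p], an element of order [p]. *)
have exs : exists s, b *+ p ^ s == 0 by exists r; exact/eqP.
case: (ex_minnP exs) => -[|s] /eqP bs smin.
  by case: tbg; rewrite -[b]mulr1n bs (bilinear0l tbil).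
have bs0 : b *+ p ^ s <> 0 by move=> /eqP/smin; rewrite ltnn.
exists (p ^ s)%N; set x := b *+ p ^ s in bs0 *.
have xp : x *+ p = 0 by rewrite /x -mulrnA mulnC -expnS.
have [//|m xm|psi [psiD _ _ psix]] :=
    hom_extending_value divisible_QmodZ (x := x) (d := Qinv p) (trivial_subgroup B).
  exact: Qp Qinvp (prime_torsion_dvd p_pr bs0 xp xm).
have [//|m gm|phi [phiD _ phiH phig]] :=
    hom_extending_value divisible_QmodZ (x := g0) (d := Qinv p) Hsub.
  exact: Qp Qinvp (g0p _ gm).
have phip : phi *+ p = 0.
  apply/funext => y; rewrite natmulfctE -(additive_mapMn phiD); apply: phiH.
  by exists y, 0; split; [exact: (torsion_subgroup G).1|rewrite addr0].
have phiS : torsion_free_character phi.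
  by split=> // s' Ts'; apply: phiH; exists 0, s'; rewrite mul0rn add0r.
(* [gam] extends 1/p |-> [phi]; since [psi x] and [phi g0] are both 1/p, [g0] fixes [psi x]. *)
have [|gam [gamD gamS _ gamQ]] := hom_extending_value
    (divisible_torsion_free_character G) (x := Qinv p) (trivial_subgroup QmodZ) phiS.
  by move=> m /(QinvMz_eq0 _ p_gt0); exact: Qp.
exists QmodZ, gam, psi, g0; split=> //.
- split=> [y u v|y y' u]; first exact: (gamS y).1.
  by rewrite gamD.
- rewrite psix -[Qinv p]mulr1z => /(QinvMz_eq0 _ p_gt0).
  by rewrite dvdzE dvdn1 /= => /eqP p1; move: p_pr; rewrite p1.
- by rewrite psix gamQ.
Qed.

Lemma detected_primary : exists k, detected G (b *+ k).
Proof.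
have [|/existsNP[i bi]] := pselect (forall i, exists b', b = b' *+ p ^ i).
  exact: detected_infinite_height.
by exists 1%N; exact: detected_finite_height bi.
Qed.

End PrimaryElement.

(** * Torsion elements and direct sums of cyclic groups *)

(** Write n = m p^r with [m] prime to [p]. By Bezout, m b or p^r b still pairs nontrivially with
    [g]: the first is [p]-primary, the second has a smaller exponent. *)
Lemma detected_torsion (B G T : zmodType) (t : B -> G -> T) (b : B) (g : G) (n : nat) :
  bilinear_map t -> t b g <> 0 -> (0 < n)%N -> b *+ n = 0 ->
  exists k, detected G (b *+ k).
Proof.
move=> tbil; elim/ltn_ind: n b => n IHn b tbg n_gt0 bn.
have [n1|n_gt1] := leqP n 1.
  case: tbg; have n1' : n = 1%N by lia.
  by rewrite -[b]mulr1n -n1' bn (bilinear0l tbil).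
have p_pr := pdiv_prime n_gt1; set p := pdiv n in p_pr.
have [m cop_pm nE] := pfactor_coprime p_pr n_gt0; set r := logn p n in nE.
have r_gt0 : (0 < r)%N by rewrite /r logn_gt0 mem_primes p_pr n_gt0 pdiv_dvd.
have m_gt0 : (0 < m)%N by move: n_gt0; rewrite nE muln_gt0 => /andP[].
have [tm0|tm] := pselect (t (b *+ m) g = 0); last first.
  have [|k] := detected_primary tbil p_pr (_ : b *+ m *+ p ^ r = 0) tm.
    by rewrite -mulrnA -nE.
  by rewrite -mulrnA; exists (m * k)%N.
have [||||k] := IHn m _ (b *+ p ^ r) => //.
- by rewrite nE -[ltnLHS]muln1 ltn_pmul2l // -[1%N](expn0 p) ltn_exp2l ?prime_gt1.
- move=> tp0; apply: tbg; apply: (@coprime_torsion _ _ (p ^ r)%N m).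
  + by rewrite coprimezE coprimeXl.
  + by rewrite -pmulrn -(bilinearMnl tbil).
  + by rewrite -pmulrn -(bilinearMnl tbil).
- by rewrite -mulrnA mulnC -nE.
by rewrite -mulrnA; exists (p ^ r * k)%N.
Qed.

Lemma detected_direct_sum (B G T : zmodType) (t : B -> G -> T) (b : B) (x : G) :
  bilinear_map t -> t b x <> 0 -> is_direct_sum_of_cyclic G -> detected G b.
Proof.
move=> tbil tbx [I [g [span indep]]].
have [i tbi] : exists i, t b (g i) <> 0.
  apply: contrapT => /forallNP/= tb0; apply: tbx.
  have [s [c [_ ->]]] := span x.
  elim/big_rec: _ => [|j y _ IH]; first exact: bilinear0r.
  rewrite tbil.1 IH (additive_mapMz (bilinear_additiver tbil b)).
  by rewrite (contrapT (tb0 j)) mul0rz addr0.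
(* [n] is 0 when [g i] has infinite order; divisibility by 0 then means being 0. *)
have [n nP] : exists n : nat, forall m : int, g i *~ m = 0 <-> (n %| m)%Z.
  have [g0|[n _ gn]] := subgroup_least_multiple (trivial_subgroup G) (g i);
    last by exists n.
  by exists 0%N => m; rewrite dvd0z; split=> [/g0 ->|/eqP -> //].
(* Asking for all larger index lists [s'] lets families be added without merging lists. *)
pose rep y (c : I -> int) := exists s : seq I, forall s', uniq s' ->
  {subset s <= s'} -> y = \sum_(j <- s') g j *~ c j.
have rep_uniq y c c' : rep y c -> rep y c' -> (n %| c i - c' i)%Z.
  move=> [s sP] [s' s'P]; apply/nP.
  have u := undup_uniq (i :: s ++ s').
  apply: (indep _ (fun j => c j - c' j) u); last by rewrite mem_undup mem_head.
  under eq_bigr do rewrite mulrzBr.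
  rewrite sumrB -sP // -?s'P ?subrr // => j js;
    by rewrite mem_undup in_cons mem_cat js ?orbT.
have repD y c y' c' : rep y c -> rep y' c' -> rep (y + y') (fun j => c j + c' j).
  move=> [s sP] [s' s'P]; exists (s ++ s') => s2 u ss2.
  under eq_bigr do rewrite mulrzDr.
  by rewrite big_split /= -sP // -?s'P // => j js; apply: ss2; rewrite mem_cat js ?orbT.
have rep1 : rep (g i) (fun j => (j == i)%:Z).
  exists [:: i] => s u /(_ i (mem_head _ _)) is_.
  rewrite (bigD1_seq i) //= eqxx big1 ?addr0 // => j /negPf ->.
  by rewrite mulr0z.
have repE y : exists c, rep y c.
  have [s [c [us ->]]] := span y.
  (* Coefficients vanish outside [s], so enlarging the list does not change the sum. *)
  exists (fun j => if j \in s then c j else 0); exists s => s' us' ss'.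
  rewrite [RHS](bigID (mem s)) /= [X in _ + X]big1 ?addr0; last first.
    by move=> j /negPf ->; rewrite mulr0z.
  rewrite [RHS](eq_bigr (fun j => g j *~ c j)); last by move=> j ->.
  rewrite -[RHS]big_filter; apply: perm_big; apply: uniq_perm => //.
    exact: filter_uniq.
  by move=> j; rewrite mem_filter /=; case: (boolP (j \in s)) => [/ss' ->|].
have [c cP] := choice repE.
apply: (@detected_cyclic _ _ _ n (c ^~ i) (g i)).
- by move=> y y'; apply: (rep_uniq _ _ _ (cP _) (repD _ _ _ _ (cP y) (cP y'))).
- by have := rep_uniq _ _ _ (cP (g i)) rep1; rewrite eqxx.
- move=> [b' bE]; apply: tbi.
  have -> : t b (g i) = t b' (g i *+ n) by rewrite bE bilinearMnl // bilinearMnr.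
  by rewrite pmulrn (_ : g i *~ n = 0) ?bilinear0r //; apply/nP.
Qed.

(** * Tensor powers and the conclusion *)

Lemma tensor_hom_ext (M N T P : zmodType) (t : M -> N -> T) (h h' : T -> P) :
  is_tensor t -> additive_map h -> additive_map h' ->
  (forall m n, h (t m n) = h' (t m n)) -> forall x, h x = h' x.
Proof.
move=> [tbil tuniv] hD h'D hh' x.
have [|k [_ _ kuniq]] := tuniv P (fun m n => h' (t m n)).
  by split=> *; rewrite ?tbil.1 ?tbil.2 h'D.
by rewrite (kuniq h) // (kuniq h').
Qed.

Lemma detected_tensor_power (B G : zmodType) (b : B)
  (P : nat -> zmodType) (e0 : G -> P 0%N) (pt : forall k, P k -> G -> P k.+1) :
  additive_map e0 -> bijective e0 -> (forall k, is_tensor (pt k)) ->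
  detected G b -> forall k, exists (Y : zmodType) (bet : B -> P k -> Y) (q : P k),
    bilinear_map bet /\ bet b q <> 0.
Proof.
move=> e0D [e1 e0K e1K] ptT [Y [gam [psi [g0 [gambil psiD psib gamb]]]]] k.
(* The induction keeps the exact value [psi b], since this is the vector known to be fixed by
   [g0]. *)
suff [bet [q [betbil betq]]] : exists (bet : B -> P k -> Y) (q : P k),
    bilinear_map bet /\ bet b q = psi b.
  by exists Y, bet, q; rewrite betq.
elim: k => [|k [bet [q [betbil betq]]]].
  exists (fun x p => gam (psi x) (e1 p)), (e0 g0); rewrite e0K; split=> //.
  have e1D : additive_map e1 by move=> x y; rewrite -[RHS]e0K e0D !e1K.
  by split=> *; rewrite ?e1D ?psiD ?gambil.1 ?gambil.2.
(* The universal property is used for each [x] separately; additivity in [x] then follows from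
   uniqueness. *)
have /choice[bet' bet'P] : forall x, exists h : P k.+1 -> Y,
    additive_map h /\ forall p g, h (pt k p g) = gam (bet x p) g.
  move=> x; have [|h [hD hE _]] := (ptT k).2 Y (fun p g => gam (bet x p) g).
    by split=> *; rewrite ?betbil.1 ?gambil.1 ?gambil.2.
  by exists h.
exists bet', (pt k q g0); split; last by rewrite (bet'P b).2 betq.
split=> [x|x y p]; first exact: (bet'P x).1.
apply: (@tensor_hom_ext _ _ _ _ _ (bet' (x + y))
  (fun p => bet' x p + bet' y p)) (ptT k) _ _ _ p.
- exact: (bet'P _).1.
- by move=> u v; rewrite (bet'P x).1 (bet'P y).1 addrACA.
- by move=> u v; rewrite !(bet'P _).2 betbil.2 gambil.2.
Qed.

(* P k models the tensor power (x)^(k+1) G:  P 0 ~= G via the additive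
   bijection e0, and P (k+1) = P k (x) G via pt k.  TA k = A (x) P k and
   TB k = B (x) P k.  The hypothesis is about A (x) G, B (x) G. *)
Theorem theoremA1
  (A B G : zmodType) (f : A -> B) (Hf : additive_map f)
  (HG : has_elt_of_infinite_order G \/ is_direct_sum_of_cyclic G)
  (TAG TBG : zmodType) (tAG : A -> G -> TAG) (tBG : B -> G -> TBG)
  (HtAG : is_tensor tAG) (HtBG : is_tensor tBG)
  (P : nat -> zmodType) (e0 : G -> P 0%N)
  (He0 : additive_map e0) (He0b : bijective e0)
  (pt : forall k : nat, P k -> G -> P k.+1)
  (Hpt : forall k : nat, is_tensor (pt k))
  (TA TB : nat -> zmodType)
  (tA : forall k : nat, A -> P k -> TA k) (tB : forall k : nat, B -> P k -> TB k)
  (HtA : forall k : nat, is_tensor (tA k)) (HtB : forall k : nat, is_tensor (tB k)) :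
  tensor_id_nontrivial tAG tBG f ->
  forall k : nat, tensor_id_nontrivial (tA k) (tB k) f.
Proof.
move=> [h [hD hE [x hx]]] k.
(* A map vanishing on all pure tensors is zero. *)
have [a [g tag]] : exists a g, tBG (f a) g <> 0.
  apply: contrapT => t0; move: hx; apply/negP; rewrite negbK; apply/eqP.
  apply: (@tensor_hom_ext _ _ _ _ _ h (fun=> 0) HtAG) => //.
    by move=> u v; rewrite addr0.
  by move=> a g; rewrite hE; apply: contrapT => n0; apply: t0; exists a, g.
have [n] : exists n, detected G (f a *+ n).
  case: HG => [[g1 g1inf]|Gsum]; last first.
    by exists 1%N; exact: detected_direct_sum HtBG.1 tag Gsum.
  have [[n n_gt0 fan]|fainf] := pselect (is_torsion (f a)).
    exact: detected_torsion HtBG.1 tag n_gt0 fan.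
  exists 1%N; apply: detected_infinite_order g1inf => n n_gt0.
  by apply/eqP => fan; apply: fainf; exists n.
move=> /(detected_tensor_power He0 He0b Hpt)/(_ k)[Y [bet [q [betbil betq]]]].
have [|h' [h'D h'E _]] := (HtA k).2 _ (fun a p => tB k (f a) p).
  by split=> *; rewrite ?Hf ?(HtB k).1.1 ?(HtB k).1.2.
exists h'; split=> //; exists (tA k (a *+ n) q); rewrite h'E (additive_mapMn Hf).
apply/eqP => tB0; apply: betq.
(* [bet] factors through [TB k], so the pure tensor cannot vanish there. *)
have [h2 [h2D h2E _]] := (HtB k).2 _ _ betbil.
by rewrite -h2E tB0 (additive_map0 h2D).
Qed.
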